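(* Let $d\geq 2$ be an integer and let $\mathbf v=(v_0,v_1,\ldots,v_{d-1})$ be a finite sequence with $v_i\in\{1,-1\}$ for all $i$ and $v_0=1$. Let $\tilde{\mathbf v}(x)=\sum_{i=0}^{d-1}v_ix^i$ and let $\mathbf f=(f_n)_{n\geq 0}$ be the $\pm1$-sequence defined by $$\sum_{n\geq 0} f_n x^n=\prod_{k=0}^{\infty}\tilde{\mathbf v}\left(x^{d^k}\right).$$ Then the sequence of reduced Hankel determinants modulo $2$ of $\mathbf f$, that is, the sequence $$\left(\frac{H_n(\mathbf f)}{2^{n-1}} \bmod 2\right)_{n\ge 0},$$ is $d$-automatic.
   Context: For a sequence $\mathbf c=(c_j)_{j\geq 0}$ and an integer $n\ge 0$, the Hankel determinant of order $n$ is $H_n(\mathbf c)=\det\left(c_{i+j}\right)_{0\leq i,j\leq n-1}$, with $H_0(\mathbf c)=1$. If $\mathbf c$ takes values in $\{1,-1\}$, then for $n\ge1$ the integer $H_n(\mathbf c)$ is divisible by $2^{n-1}$, and the integer $H_n(\mathbf c)/2^{n-1}$ is called the reduced Hankel determinant of order $n$ (for $n=0$ this expression equals $2$, hence is $0$ modulo $2$). The sequence $\mathbf f$ is equivalently given by $f_0=1$ and $f_{dn+i}=v_if_n$ for $n\geq 0$, $0\leq i\leq d-1$. A sequence $(u(n))_{n\geq 0}$ with values in a finite set $\Delta$ is $d$-automatic if it is generated by a deterministic finite automaton with output $(Q,\Sigma,\delta,q_0,\Delta,\tau)$, where $Q$ is a finite set of states, $q_0\in Q$ is the initial state, $\Sigma=\{0,1,\ldots,d-1\}$,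 $\delta:Q\times\Sigma\to Q$ is the transition function, and $\tau:Q\to\Delta$ is the output function: for each $n$, the base-$d$ expansion of $n$ is read from right to left (least significant digit first) starting from $q_0$, and if $q$ is the state reached at the end then $u(n)=\tau(q)$. Equivalently, $(u(n))_{n\ge0}$ is $d$-automatic if and only if its $d$-kernel $\{(u(d^kn+j))_{n\geq 0}\mid k\in\mathbb N,\ 0\leq j\leq d^k-1\}$ is a finite set of sequences. *)

(* Defs.v *)
From mathcomp Require Import all_boot all_order all_algebra.

Set Implicit Arguments.
Unset Strict Implicit.
Unset Printing Implicit Defensive.

Import Order.TTheory GRing.Theory Num.Theory.

Local Open Scope ring_scope.

Definition hankel (c : nat -> int) (n : nat) : int :=
  \det (\matrix_(i < n, j < n) c (i + j)%N).

(* H_n(c) / 2^(n-1), written as 2 H_n(c) / 2^n so that n = 0 needs no separate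
   case (its value is then 2).  The division is exact when c takes its values
   in {1, -1}: see reduced_hankelK. *)
Definition reduced_hankel (c : nat -> int) (n : nat) : int :=
  ((2 * hankel c n) %/ 2 ^+ n)%Z.

Definition reduced_hankel_mod2 (c : nat -> int) (n : nat) : 'F_2 :=
  (reduced_hankel c n)%:~R.

Lemma hankel_dvd (c : nat -> int) (n : nat) :
  (forall k, c k = 1 \/ c k = -1) -> (2 ^+ n %| hankel c n.+1)%Z.
Proof.
move=> hc.
pose A := \matrix_(i < n.+1, j < n.+1) c (i + j)%N.
pose M : 'M[int]_n.+1 :=
  \matrix_(i, j) if j == ord0 then 1 else (i == j)%:R * 2.
pose C : 'M[int]_n.+1 :=
  \matrix_(i, j) if i == ord0 then A ord0 j else ((A i j - A ord0 j) %/ 2)%Z.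
have h2 i j : (2 %| A i j - A ord0 j)%Z.
  rewrite !mxE; move: (_ + j)%N (_ + j)%N => a b.
  by case: (hc a) => ->; case: (hc b) => ->.
have -> : hankel c n.+1 = \det (M *m C).
  rewrite /hankel -/A; congr (\det _); apply/matrixP=> i j.
  rewrite [RHS]mxE big_ord_recl ![in X in _ = X + _]mxE !eqxx mul1r.
  case: (unliftP ord0 i) => [k ->|->]; last first.
    by rewrite big1 ?addr0 // ?mxE //= => m _; rewrite !mxE /= !mul0r.
  rewrite (bigD1 k) //= big1 => [|m hm]; last first.
    by rewrite !mxE /= (inj_eq lift_inj) eq_sym (negbTE hm) !mul0r.
  rewrite addr0 [M _ _]mxE [C _ _]mxE /= eqxx mul1r mulrC divzK //.
  by rewrite !mxE addrC subrK.
rewrite det_mulmx det_trig; last first.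
  apply/is_trig_mxP=> i j ij; rewrite mxE.
  have /negbTE-> : j != ord0 by rewrite -val_eqE /= -lt0n (leq_ltn_trans _ ij).
  by rewrite -val_eqE /= ltn_eqF ?mul0r.
rewrite big_ord_recl mxE eqxx mul1r (eq_bigr (fun=> 2)) => [|i _].
  by rewrite prodr_const card_ord dvdz_mulr.
by rewrite mxE /= eqxx mul1r.
Qed.

Lemma reduced_hankelK (c : nat -> int) (n : nat) :
  (forall k, c k = 1 \/ c k = -1) ->
  reduced_hankel c n * 2 ^+ n = 2 * hankel c n.
Proof.
move=> hc; apply: divzK; case: n => [|n]; first by rewrite expr0 dvd1z.
by rewrite exprS dvdz_mul2l // hankel_dvd.
Qed.

(* sum_n f_n x^n = prod_(k >= 0) P_k(x) as formal power series: each
   coefficient of the partial products is eventually constant, equal to f_n. *)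
Definition is_infprod (P : nat -> {poly int}) (f : nat -> int) : Prop :=
  forall n, exists K, forall k, (K <= k)%N -> (\prod_(j < k) P j)`_n = f n.

Definition vpoly (d : nat) (v : d.-tuple int) : {poly int} :=
  \sum_(i < d) tnth v i *: 'X^i.

Record dfao (d : nat) (Delta : finType) := Dfao {
  dfao_state : finType;
  dfao_init : dfao_state;
  dfao_trans : dfao_state -> 'I_d -> dfao_state;
  dfao_out : dfao_state -> Delta
}.

Definition dfao_run (d : nat) (Delta : finType) (A : dfao d Delta)
    (w : seq 'I_d) : Delta :=
  dfao_out (foldl (@dfao_trans d Delta A) (dfao_init A) w).

(* w is the base-d expansion of n, least significant digit first and without
   leading zeros; the expansion of 0 is the empty word. *)
Definition is_expansion (d : nat) (n : nat) (w : seq 'I_d) : Prop :=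
  n = (\sum_(i < size w) tnth (in_tuple w) i * d ^ i)%N
  /\ last 1%N [seq val a | a <- w] != 0%N.

Definition automatic (d : nat) (Delta : finType) (u : nat -> Delta) : Prop :=
  exists A : dfao d Delta,
    forall n, exists2 w : seq 'I_d, is_expansion n w & u n = dfao_run A w.

(* Main.v *)
Require Import Defs.
From mathcomp Require Import all_boot all_order all_algebra.
From mathcomp Require Import zify.

Import Order.TTheory GRing.Theory Num.Theory.

Local Open Scope ring_scope.

(* Put y_k = (f_k - f_{k+1})/2 mod 2.  Subtracting consecutive rows shows that,
   for n >= 1, the reduced Hankel determinant mod 2 is the determinant over F_2
   whose rows are (y_{i+j})_j for i < n - 1 together with a row of ones.  It
   vanishes iff some p <> 0 in F_2^n has sum 0 and satisfies
   sum_j y_{i+j} p_j = 0 for all i < n - 1.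

   The digit rule for f gives y_{dq+r} = c_r + [r = d-1] y_q, so splitting p and
   the index i into residue classes mod d turns such a system into d systems of
   the same kind of sizes about n/d, coupled only through the sums e_a of the
   parts p_a, which enter as constant right-hand sides.  Hence let profile k l be
   the finite set of triples (p <> 0, sum p, t) over the p in F_2^k with
   sum_j y_{i+j} p_j = t for all i < l.  The profiles with k, l in
   {dm+r-1, dm+r, dm+r+1} are determined by r and those with k, l in
   {m-1, m, m+1}, so they are the states of a finite automaton. *)

(** * Splitting an index range into residue classes modulo [d] *)

(** For [a < d], the number of integers below [k] congruent to [a] modulo [d]; adding [d] first
    keeps the subtraction from truncating. *)
Definition residue_count (d a k : nat) : nat := (k + d - a.+1) %/ d.

Lemma ltn_residue_count (d a k j : nat) :
  (a < d)%N -> (j < residue_count d a k)%N = (j * d + a < k)%N.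
Proof.
move=> ad; rewrite /residue_count leq_divRL ?(leq_ltn_trans _ ad) //.
rewrite mulSn; apply/idP/idP; lia.
Qed.

Lemma residue_countS (d a k : nat) :
  (a < d)%N -> residue_count d a k.+1 = (residue_count d a k + (a == k %% d))%N.
Proof.
move=> ad; have h := @ltn_residue_count d a _ _ ad.
have d0 : (0 < d)%N by apply: leq_ltn_trans ad.
have [ea|na] := eqVneq a (k %% d)%N.
  rewrite /residue_count {1 2}(divn_eq k d) -ea addn1.
  have -> : ((k %/ d * d + a).+1 + d - a.+1 = (k %/ d).+1 * d)%N by lia.
  have -> : (k %/ d * d + a + d - a.+1 = k %/ d * d + d.-1)%N by lia.
  by rewrite mulnK // divnMDl // (@divn_small d.-1) ?addn0 // prednK.
rewrite addn0; apply/eqP; rewrite eqn_leq; apply/andP; split; last first.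
  by apply: leq_div2r; lia.
rewrite leqNgt h; apply/negP; rewrite ltnS leq_eqVlt -h ltnn orbF => /eqP e.
by case/eqP: na; rewrite -e modnMDl modn_small.
Qed.

Lemma residue_count_mod (d k : nat) :
  (0 < d)%N -> residue_count d (k %% d) k = (k %/ d)%N.
Proof.
move=> d0; have rd := ltn_pmod k d0.
rewrite /residue_count {1}(divn_eq k d).
have -> : (k %/ d * d + k %% d + d - (k %% d).+1 = k %/ d * d + d.-1)%N by lia.
by rewrite divnMDl // (@divn_small d.-1) ?addn0 // prednK.
Qed.

Lemma sum_residues (V : nmodType) (d k : nat) (F : nat -> V) :
  (0 < d)%N ->
  \sum_(j < k) F j =
  \sum_(a < d) \sum_(j < residue_count d a k) F (j * d + a)%N.
Proof.
move=> d0; elim: k => [|k IHk].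
  rewrite big_ord0 big1 // => a _; rewrite /residue_count divn_small ?big_ord0 //.
  by have := ltn_ord a; lia.
rewrite big_ord_recr /= IHk.
pose r := Ordinal (ltn_pmod k d0).
rewrite [RHS](bigD1 r) //= [X in X + _](bigD1 r) //= addrAC; congr (_ + _).
  rewrite residue_countS ?ltn_pmod // eqxx addn1 big_ord_recr /=.
  by rewrite residue_count_mod // -divn_eq.
apply: eq_bigr => a ar; rewrite residue_countS //.
by have /negbTE-> : (a : nat) != (k %% d)%N; rewrite ?addn0.
Qed.

Lemma exists_residues (d k : nat) (P : pred nat) :
  (0 < d)%N ->
  [exists j : 'I_k, P j] =
  [exists a : 'I_d, [exists j : 'I_(residue_count d a k), P (j * d + a)%N]].
Proof.
move=> d0; apply/existsP/existsP => [[j Pj]|[a /existsP[j Pj]]].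
  exists (Ordinal (ltn_pmod j d0)); apply/existsP => /=.
  have lt : (j %/ d < residue_count d (j %% d) k)%N.
    by rewrite ltn_residue_count ?ltn_pmod // -divn_eq.
  by exists (Ordinal lt); rewrite /= -divn_eq.
have lt : (j * d + a < k)%N by rewrite -ltn_residue_count.
by exists (Ordinal lt).
Qed.

(** * Profiles of the linear systems and their recursion on digits *)

Section Profile.
Variables (F : finFieldType) (y : nat -> F).

Definition profile (k l : nat) : {set bool * F * F} :=
  [set x | [exists p : {ffun 'I_k -> F},
    [&& [exists j, p j != 0] == x.1.1, \sum_j p j == x.1.2 &
        [forall i : 'I_l, \sum_(j < k) y (i + j)%N * p j == x.2]]]].

(** Vectors become functions on [nat] whose values beyond [k] are ignored, so that reindexing by
    [j * d + a] needs no bound proofs. *)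
Lemma profileP (k l : nat) (z : bool) (e t : F) :
  reflect (exists p : nat -> F,
    [/\ [exists j : 'I_k, p j != 0] = z, \sum_(j < k) p j = e &
        forall i, (i < l)%N -> \sum_(j < k) y (i + j)%N * p j = t])
    ((z, e, t) \in profile k l).
Proof.
rewrite inE; apply: (iffP existsP) => /= [[p /and3P[/eqP pz /eqP pe /forallP pt]]|].
  pose q j := if insub j is Some j' then p j' else 0.
  have qE (j : 'I_k) : q j = p j by rewrite /q valK.
  exists q; split.
  - by rewrite -pz; apply: eq_existsb => j; rewrite qE.
  - by rewrite -pe; apply: eq_bigr => j _; rewrite qE.
  move=> i il; rewrite -(eqP (pt (Ordinal il))).
  by apply: eq_bigr => j _; rewrite qE.
case=> p [pz pe pt]; exists [ffun j : 'I_k => p j]; apply/and3P; split.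
- by apply/eqP; rewrite -pz; apply: eq_existsb => j; rewrite ffunE.
- by apply/eqP; rewrite -pe; apply: eq_bigr => j _; rewrite ffunE.
apply/forallP => i; apply/eqP; rewrite -(pt i) //.
by apply: eq_bigr => j _; rewrite ffunE.
Qed.

Variables (d : nat) (c : nat -> F).
Hypothesis d_gt0 : (0 < d)%N.
Hypothesis yE : forall q r, (r < d)%N -> y (q * d + r)%N = c r + y q *+ (r == d.-1).

(** The recursive term of [yE] needs last digit [d - 1]. Row class [d - 1 - a] plus column class [b]
    gives it only for [b = a]; if [b > a] there is a carry, and the last digit [b - a - 1] is too
    small. *)
Lemma y_residues (a b : 'I_d) (i j : nat) :
  y ((i * d + rev_ord a) + (j * d + b))%N =
  c ((b + rev_ord a) %% d)%N + y (i + j)%N *+ (b == a).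
Proof.
have [ad bd] := (ltn_ord a, ltn_ord b).
have [lt|ge] := ltnP (b + rev_ord a) d.
  have -> : ((i * d + rev_ord a) + (j * d + b) = (i + j) * d + (b + rev_ord a))%N.
    by lia.
  rewrite yE // modn_small // -val_eqE /=; congr (_ + _ *+ _); congr nat_of_bool.
  by apply/eqP/eqP; lia.
have lt : (b + rev_ord a - d < d)%N by rewrite /=; lia.
have -> : ((i * d + rev_ord a) + (j * d + b) =
            (i + j).+1 * d + (b + rev_ord a - d))%N.
  by rewrite mulSn; lia.
have /negbTE-> : b != a by apply: contraL ge => /eqP->; rewrite /=; lia.
rewrite yE // -[in RHS](subnK ge) modnDr modn_small //.
by rewrite (_ : _ == d.-1 = false) //; apply/eqP; rewrite /= in ge lt *; lia.
Qed.

Lemma sum_y_residues (k i : nat) (a : 'I_d) (p : nat -> F) :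
  \sum_(j < k) y ((i * d + rev_ord a) + j)%N * p j =
  \sum_(j < residue_count d a k) y (i + j)%N * p (j * d + a)%N +
  \sum_(b < d) c ((b + rev_ord a) %% d)%N *
    \sum_(j < residue_count d b k) p (j * d + b)%N.
Proof.
rewrite (@sum_residues _ d k (fun j => y ((i * d + rev_ord a) + j)%N * p j)) //.
rewrite (eq_bigr (fun b : 'I_d =>
  (if b == a then \sum_(j < residue_count d b k) y (i + j)%N * p (j * d + b)%N
   else 0) + c ((b + rev_ord a) %% d)%N *
    \sum_(j < residue_count d b k) p (j * d + b)%N)); last first.
  move=> b _; rewrite mulr_sumr.
  have [->|ba] := eqVneq b a.
    rewrite -big_split /=; apply: eq_bigr => j _.
    by rewrite y_residues eqxx mulr1n mulrDl addrC.
  rewrite add0r; apply: eq_bigr => j _.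
  by rewrite y_residues (negbTE ba) mulr0n addr0.
by rewrite big_split /= -big_mkcond big_pred1_eq.
Qed.

(** Here [s] records the nonzero flag and the sum of each part of [p]. By [sum_y_residues], once the
    sums are fixed the rows of class [rev_ord a] constrain part [a] alone, so the parts can be
    chosen independently. *)
Lemma profile_residues (k l : nat) (z : bool) (e t : F) :
  ((z, e, t) \in profile k l) =
  [exists s : {ffun 'I_d -> bool * F},
    [&& [exists a, (s a).1] == z, \sum_a (s a).2 == e &
        [forall a, (s a, t - \sum_(b < d) c ((b + rev_ord a) %% d)%N * (s b).2)
           \in profile (residue_count d a k) (residue_count d (rev_ord a) l)]]].
Proof.
apply/profileP/existsP => [[p [pz pe pt]]|[s /and3P[/eqP sz /eqP se /forallP st]]].
  exists [ffun a : 'I_d =>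
     ([exists j : 'I_(residue_count d a k), p (j * d + a)%N != 0],
      \sum_(j < residue_count d a k) p (j * d + a)%N)].
  apply/and3P; split.
  - rewrite -pz (@exists_residues d k (fun j => p j != 0)) //; apply/eqP.
    by apply: eq_existsb => a; rewrite ffunE.
  - rewrite -pe (@sum_residues _ d) //; apply/eqP.
    by apply: eq_bigr => a _; rewrite ffunE.
  apply/forallP => a; rewrite ffunE; apply/profileP.
  exists (fun j => p (j * d + a)%N); split=> // i il.
  rewrite -(pt (i * d + rev_ord a)%N); last by rewrite -ltn_residue_count.
  rewrite sum_y_residues [X in _ - X](eq_bigr _ (fun b _ =>
    congr1 (fun u => _ * u.2) (ffunE _ b))) /=.
  by rewrite addrK.
have {st} /fin_all_exists[p ps] (a : 'I_d) : exists p : nat -> F,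
    [/\ [exists j : 'I_(residue_count d a k), p j != 0] = (s a).1,
        \sum_(j < residue_count d a k) p j = (s a).2 &
        forall i, (i < residue_count d (rev_ord a) l)%N ->
          \sum_(j < residue_count d a k) y (i + j)%N * p j =
          t - \sum_(b < d) c ((b + rev_ord a) %% d)%N * (s b).2].
  by apply/profileP; rewrite -surjective_pairing.
(* Interleave the chosen parts into a single vector. *)
pose q j := p (Ordinal (ltn_pmod j d_gt0)) (j %/ d)%N.
have qE (a : 'I_d) j : q (j * d + a)%N = p a j.
  rewrite /q divnMDl // divn_small // addn0; congr (p _ _).
  by apply: val_inj; rewrite /= modnMDl modn_small.
exists q; split.
- rewrite (@exists_residues d k (fun j => q j != 0)) // -sz.
  apply: eq_existsb => a; case: (ps a) => <- _ _.
  by apply: eq_existsb => j; rewrite qE.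
- rewrite (@sum_residues _ d) // -se; apply: eq_bigr => a _.
  by case: (ps a) => _ <- _; apply: eq_bigr => j _; rewrite qE.
move=> i il.
pose a := rev_ord (Ordinal (ltn_pmod i d_gt0)).
have ra : rev_ord a = (i %% d)%N :> nat by rewrite /a rev_ordK.
rewrite {1}(divn_eq i d) -ra sum_y_residues.
have lt : (i %/ d < residue_count d (rev_ord a) l)%N.
  by rewrite ltn_residue_count // ra -divn_eq.
case: (ps a) => _ _ /(_ _ lt) h.
rewrite -[RHS](subrK (\sum_(b < d) c ((b + rev_ord a) %% d)%N * (s b).2)) -h.
congr (_ + _); apply: eq_bigr => b _; first by rewrite qE.
congr (_ * _); case: (ps b) => _ <- _.
by apply: eq_bigr => j _; rewrite qE.
Qed.

Definition state : finType := {ffun 'I_3 * 'I_3 -> {set bool * F * F}}.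

(* The windows [m - 1, m, m + 1] suffice: they are stable under taking residues.
   At m = 0 the size m - 1 is truncated to 0. *)
Definition state_at (m : nat) : state :=
  [ffun ij : 'I_3 * 'I_3 => profile (m + ij.1).-1 (m + ij.2).-1].

(** Class [a] below [m * d + r + i - 1] has [m + (r + i + d - a - 2) %/ d] members when nothing
    truncates; the extra [d] turns this into the form [m + w - 1]. The numerator lies in
    [[d - 1, 3 * d - 1]], so [inord] never defaults. *)
Definition residue_window (r : 'I_d) (i : 'I_3) (a : 'I_d) : 'I_3 :=
  inord ((r + i + d.*2 - a.+2) %/ d).

Lemma residue_count_window (m : nat) (r : 'I_d) (i : 'I_3) (a : 'I_d) :
  residue_count d a (m * d + r + i).-1 = (m + residue_window r i a).-1.
Proof.
have [rd id ad] := And3 (ltn_ord r) (ltn_ord i) (ltn_ord a).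
rewrite /residue_window inordK; last first.
  by rewrite ltn_divLR // mulSn mulSn mul1n -addnn; lia.
rewrite /residue_count.
set X := (r + i + d.*2 - a.+2)%N.
have [Xd|dX] := ltnP X d.
  (* Offset 0 arises only here, and for [m = 0] both predecessors truncate to 0. *)
  have [r0 i0 aE] : [/\ r = 0%N :> nat, i = 0%N :> nat & a = d.-1 :> nat].
    by rewrite /X -addnn in Xd; split; lia.
  rewrite (divn_small Xd) r0 i0 aE !addn0 prednK // addnK.
  case: m => [|m]; first by rewrite mul0n div0n.
  rewrite (_ : (m.+1 * d).-1 = m * d + d.-1)%N; last by rewrite mulSn; lia.
  by rewrite divnMDl // divn_small ?addn0 // prednK.
have XdE : (X %/ d = ((X - d) %/ d).+1)%N.
  by rewrite -{1}(subnKC dX) -{1}(mul1n d) divnMDl.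
(* The remaining truncated case: the size is 0, the offset 1, and both sides vanish. *)
have [k0|k0] := posnP (m * d + r + i)%N.
  have m0 : m = 0%N by case: (m) k0 => // m'; rewrite mulSn; lia.
  by rewrite k0 XdE m0 add0n !divn_small // /X -?addnn; lia.
have -> : ((m * d + r + i).-1 + d - a.+1 = m * d + (X - d))%N.
  by rewrite /X -addnn in dX *; lia.
by rewrite divnMDl // XdE addnS.
Qed.

Definition step (r : 'I_d) (q : state) : state :=
  [ffun ij : 'I_3 * 'I_3 => [set x | [exists s : {ffun 'I_d -> bool * F},
    [&& [exists a, (s a).1] == x.1.1, \sum_a (s a).2 == x.1.2 &
        [forall a, (s a, x.2 - \sum_(b < d) c ((b + rev_ord a) %% d)%N * (s b).2)
           \in q (residue_window r ij.1 a, residue_window r ij.2 (rev_ord a))]]]]].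

Lemma state_at_step (m : nat) (r : 'I_d) :
  state_at (m * d + r) = step r (state_at m).
Proof.
apply/ffunP => -[i j]; rewrite !ffunE; apply/setP => -[[z e] t].
rewrite profile_residues !inE /=.
apply: eq_existsb => s; congr [&& _, _ & _]; apply: eq_forallb => a.
rewrite [state_at m _]ffunE residue_count_window.
by rewrite (residue_count_window m r j (rev_ord a)).
Qed.

End Profile.

(** * Base-[d] expansions, and automata obtained from digit recursions *)

Lemma expansion_exists (d n : nat) :
  (1 < d)%N -> exists w : seq 'I_d, is_expansion n w.
Proof.
move=> d1; have d0 := ltnW d1.
have [N] := ubnP n; elim: N n => // N IHN [|n] nN.
  by exists [::]; split; rewrite ?big_ord0.
have /IHN[w [wn wl]] : (n.+1 %/ d < N)%N.
  by apply: leq_trans (ltn_Pdiv d1 _) _.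
exists (Ordinal (ltn_pmod n.+1 d0) :: w); split.
  rewrite big_ord_recl /= expn0 muln1.
  rewrite {1}(divn_eq n.+1 d) addnC {1}wn big_distrl; congr addn.
  apply: eq_bigr => i _; rewrite expnSr mulnA; congr (_ * _ * _)%N.
  by rewrite !(tnth_nth (Ordinal (ltn_pmod n.+1 d0))).
(* The new digit is the leading one only if the quotient is 0; it then equals the positive number
   itself. *)
case: w wn wl => [|a w] //=; rewrite big_ord0 => wn _.
by rewrite [X in X != _](_ : _ = n.+1) // {2}(divn_eq n.+1 d) wn.
Qed.

(* The automaton reads the least significant digit first whereas the states
   compose from the most significant one, so its states are maps of Q. *)
Lemma automatic_of_step (d : nat) (Delta Q : finType) (u : nat -> Delta)
    (q : nat -> Q) (delta : 'I_d -> Q -> Q) (out : Q -> Delta) :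
  (1 < d)%N -> (forall m (r : 'I_d), q (m * d + r)%N = delta r (q m)) ->
  (forall n, u n = out (q n)) -> automatic d u.
Proof.
move=> d1 qE uE.
pose A := @Dfao d Delta {ffun Q -> Q} [ffun x => x]
  (fun g r => [ffun x => g (delta r x)]) (fun g => out (g (q 0%N))).
exists A => n; have [w wn] := expansion_exists d n d1; exists w => //.
case: wn => -> _; rewrite uE /dfao_run /=.
(* Reading a digit changes the starting map, so the induction is over all [g]; the identity map
   gives the claim. *)
suff H (g : {ffun Q -> Q}) :
    g (q (\sum_(i < size w) tnth (in_tuple w) i * d ^ i)%N) =
    foldl (@dfao_trans d Delta A) g w (q 0%N).
  by rewrite -H ffunE.
elim: w g => [|a w IHw] g /=; first by rewrite big_ord0.
rewrite -IHw ffunE -qE; congr (g (q _)).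
rewrite big_ord_recl /= expn0 muln1 addnC big_distrl /=; congr addn.
by apply: eq_bigr => i _; rewrite expnSr mulnA !(tnth_nth a).
Qed.

(** * Reduced Hankel determinants modulo 2 in terms of profiles *)

Section PmOne.
Variable f : nat -> int.
Hypothesis f_pm1 : forall k, f k = 1 \/ f k = -1.

(** By telescoping, row [i] of the Hankel matrix is its last row plus twice the halved differences
    of rows [k, k + 1] for [i <= k < n]. This factors it through the triangular [M] with diagonal
    [2, ..., 2, 1], whose determinant cancels the power of 2. *)
Lemma reduced_hankel_det (n : nat) :
  reduced_hankel f n.+1 =
  \det (\matrix_(i < n.+1, j < n.+1)
    if i == ord_max then f (n + j)%N else ((f (i + j)%N - f (i + j).+1) %/ 2)%Z).
Proof.
set C := \matrix_(i, j) _.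
pose M : 'M[int]_n.+1 :=
  \matrix_(i, k) if k == ord_max then 1 else if (i <= k)%N then 2 else 0.
have h2 a b : (2 %| f a - f b)%Z.
  by case: (f_pm1 a) => ->; case: (f_pm1 b) => ->.
have hE : hankel f n.+1 = \det (M *m C).
  congr (\det _); apply/matrixP => i j; rewrite !mxE.
  rewrite big_ord_recr /= !mxE !eqxx mul1r.
  under eq_bigr => k _.
    rewrite !mxE.
    have /negbTE-> : widen_ord (leqnSn n) k != ord_max.
      by rewrite -val_eqE /= ltn_eqF.
    rewrite /= (_ : _ * _ = if (i <= k)%N then f (k + j)%N - f (k + j).+1 else 0);
      last by case: ifP => _; rewrite ?mul0r // mulrC divzK.
    over.
  rewrite -big_mkcond /=.
  have -> : \sum_(k < n | (i <= k)%N) (f (k + j)%N - f (k + j).+1) =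
            \sum_(i <= k < n) (f (k + j)%N - f (k + j).+1).
    rewrite big_geq_mkord; exact: eq_bigl.
  rewrite (telescope_sumr_eq (fun k => - f (k + j)%N)) ?leq_ord //.
    by rewrite opprK addrAC addNr add0r.
  by move=> k _; rewrite opprK addrC.
have dM : \det M = 2 ^+ n.
  rewrite -det_tr det_trig; last first.
    apply/is_trig_mxP => i j ij; rewrite !mxE leqNgt ij /=.
    by rewrite -val_eqE /= ltn_eqF // (leq_trans ij) // -ltnS.
  rewrite big_ord_recr /= !mxE eqxx mulr1 -[n in RHS]card_ord -prodr_const.
  apply: eq_bigr => k _; rewrite !mxE leqnn.
  by rewrite -val_eqE /= ltn_eqF.
apply/(mulIf (x := 2 ^+ n.+1)); first by rewrite expf_neq0.
by rewrite reduced_hankelK // hE det_mulmx dM mulrA -exprS mulrC.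
Qed.

(** The isomorphism from the group of signs to the additive group of ['F_2]; it makes the digit rule
    additive. *)
Definition sign_bit (x : int) : 'F_2 := (x != 1)%:R.

Lemma sign_bitM (x x' : int) : x = 1 \/ x = -1 -> x' = 1 \/ x' = -1 ->
  sign_bit (x * x') = sign_bit x + sign_bit x'.
Proof. by move=> [->|->] [->|->]; apply/eqP. Qed.

Lemma half_sub_mod2 (x x' : int) : x = 1 \/ x = -1 -> x' = 1 \/ x' = -1 ->
  ((x - x') %/ 2)%Z%:~R = sign_bit x + sign_bit x'.
Proof. by move=> [->|->] [->|->]; apply/eqP. Qed.

Lemma pm1_mod2 (x : int) : x = 1 \/ x = -1 -> x%:~R = 1 :> 'F_2.
Proof. by move=> [->|->]; apply/eqP. Qed.

(** The sequence [y] of the overview, by [half_sub_mod2]. *)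
Definition bit_diff (k : nat) : 'F_2 := sign_bit (f k) + sign_bit (f k.+1).

(* The first condition is implied by the second one when n > 0; it makes the
   right-hand side vanish at n = 0. *)
Lemma reduced_hankel_mod2_profile (n : nat) :
  reduced_hankel_mod2 f n =
  (((true, 1, 0) \in profile _ bit_diff n n.-1) &&
   ((true, 0, 0) \notin profile _ bit_diff n n.-1))%:R.
Proof.
case: n => [|n].
  have -> : reduced_hankel_mod2 f 0 = 0.
    by rewrite /reduced_hankel_mod2 /reduced_hankel /hankel det_mx00; apply/eqP.
  by case: profileP => // -[p [/existsP[[]]]].
rewrite /reduced_hankel_mod2 reduced_hankel_det -det_map_mx /=.
set C := map_mx _ _.
have CE (i j : 'I_n.+1) :
    C i j = if i == ord_max then 1 else bit_diff (i + j).
  rewrite !mxE; case: ifP => _; first exact: pm1_mod2.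
  exact: half_sub_mod2.
have F2 (x : 'F_2) : x = (x != 0)%:R by case: x => -[|[|]] // ?; apply/eqP.
have CM (p : 'cV['F_2]_n.+1) (i : 'I_n.+1) : (C *m p) i 0 =
    if i == ord_max then \sum_j p j 0 else \sum_(j < n.+1) bit_diff (i + j) * p j 0.
  rewrite mxE; case: ifP => ci; apply: eq_bigr => j _; rewrite CE ci //.
  by rewrite mul1r.
have lt_max (i : 'I_n.+1) : i != ord_max -> (i < n)%N.
  by move=> ine; rewrite ltn_neqAle -ltnS ltn_ord andbT; exact: ine.
rewrite [LHS]F2; congr (nat_of_bool _)%:R; apply/idP/andP => [C0|[_]].
  have Cu : C \in unitmx by rewrite unitmxE unitfE.
  split.
    (* The preimage of the last basis vector has sum 1, hence is nonzero, and is annihilated by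
       every other row. *)
    pose p := invmx C *m (delta_mx ord_max 0 : 'cV_n.+1).
    have Cp : C *m p = delta_mx ord_max 0 by rewrite mulKVmx.
    have p1 : \sum_j p j 0 = 1.
      by have := CM p ord_max; rewrite eqxx Cp mxE !eqxx.
    apply/profileP; exists (fun j => p (inord j) 0); split.
    - apply/existsP.
      case: (pickP (fun j : 'I_n.+1 => p (inord j) 0 != 0)) => [j pj|p0].
        by exists j.
      have /eqP : \sum_j p j 0 = 0.
        by apply: big1 => j _; have /negbFE/eqP := p0 j; rewrite inord_val.
      by rewrite p1.
    - by rewrite -p1; apply: eq_bigr => j _; rewrite inord_val.
    move=> i il; have il' : (i < n.+1)%N by apply: leq_trans il _.
    have := CM p (Ordinal il'); rewrite Cp mxE.
    have /negbTE-> : Ordinal il' != ord_max by rewrite -val_eqE /= ltn_eqF.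
    move=> /= e; rewrite [RHS]e; apply: eq_bigr => j _; by rewrite inord_val.
  (* A nonzero solution of sum 0 would lie in the kernel of the invertible [C]. *)
  apply/negP => /profileP[p [/existsP[j pj] p0 pi]].
  have Cp : C *m (\col_j p j) = 0.
    apply/matrixP => i k; rewrite (ord1 k) CM [RHS]mxE.
    case: ifP => [_|/negbT/lt_max ci].
      by rewrite -[RHS]p0; apply: eq_bigr => j' _; rewrite mxE.
    by rewrite -[RHS](pi _ ci); apply: eq_bigr => j' _; rewrite mxE.
  have : (\col_j p j : 'cV_n.+1) j 0 = 0.
    by rewrite -(mulKmx Cu (\col_j p j)) Cp mulmx0 mxE.
  by rewrite mxE => /eqP; rewrite (negbTE pj).
(* Conversely, a singular [C] has a nonzero kernel vector; [det0P] yields row vectors, hence the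
   transposition. *)
apply: contra; rewrite -det_tr => /det0P[v v0 vC].
apply/profileP; exists (fun j => v 0 (inord j)).
have Cv : C *m v^T = 0 by rewrite -[LHS]trmxK trmx_mul trmxK vC trmx0.
split.
- apply/existsP; have [j vj] := rV0Pn _ v0.
  by exists j; rewrite inord_val.
- have := CM v^T ord_max; rewrite Cv mxE eqxx => e; rewrite [RHS]e.
  by apply: eq_bigr => j _; rewrite mxE inord_val.
move=> i il; have il' : (i < n.+1)%N by apply: leq_trans il _.
have := CM v^T (Ordinal il'); rewrite Cv mxE.
have /negbTE-> : Ordinal il' != ord_max by rewrite -val_eqE /= ltn_eqF.
move=> /= e; rewrite [RHS]e; apply: eq_bigr => j _; by rewrite mxE inord_val.
Qed.

End PmOne.

(** * The digit rule for [f], from the infinite product *)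

Section Product.
Variables (d : nat) (v : d.-tuple int).
Hypothesis d_gt0 : (0 < d)%N.

(** Exponents of [p \Po 'X^d] are multiples of [d], so only the term of degree [r] of [vpoly v] can
    reach exponent [q * d + r]. *)
Lemma coef_vpoly_comp (p : {poly int}) (q : nat) (r : 'I_d) :
  (vpoly v * (p \Po 'X^d))`_(q * d + r) = tnth v r * p`_q.
Proof.
rewrite mulr_suml coef_sum (bigD1 r) //= big1 ?addr0 => [|i ir].
  rewrite -scalerAl coefZ coefXnM ltnNge leq_addl /= addnK.
  by rewrite coef_comp_poly_Xn // dvdn_mull // mulnK.
rewrite -scalerAl coefZ coefXnM coef_comp_poly_Xn //.
case: ltnP => [|le]; first by rewrite mulr0.
case: ifP => [|_]; last by rewrite mulr0.
rewrite -eqn_mod_dvd // modnMDl !modn_small // => /eqP e.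
by case/eqP: ir; apply: val_inj.
Qed.

(** The truncated form of the functional equation [F(x) = v(x) F(x^d)]. *)
Lemma prod_vpolyS (k : nat) :
  \prod_(j < k.+1) (vpoly v \Po 'X^(d ^ j)) =
  vpoly v * ((\prod_(j < k) (vpoly v \Po 'X^(d ^ j))) \Po 'X^d).
Proof.
rewrite big_ord_recl expn0 comp_polyXr rmorph_prod; congr (_ * _).
apply: eq_bigr => j _ /=; rewrite -comp_polyA comp_Xn_poly /bump add1n.
by rewrite -exprM -expnS.
Qed.

Variable f : nat -> int.
Hypothesis hf : is_infprod (fun k => vpoly v \Po 'X^(d ^ k)) f.

Lemma infprod_digit (q : nat) (r : 'I_d) : f (q * d + r)%N = tnth v r * f q.
Proof.
have [[K hK] [L hL]] := (hf (q * d + r)%N, hf q).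
(* One factor is split off, so [maxn K L] factors must remain for the coefficient at [q] to be
   stable too. *)
rewrite -(hK (maxn K L).+1) -?(hL (maxn K L)) ?leq_maxr //.
  by rewrite prod_vpolyS coef_vpoly_comp.
by rewrite leqW ?leq_maxl.
Qed.

Lemma infprod0 : v`_0 = 1 -> f 0%N = 1.
Proof.
move=> v0; have [K hK] := hf 0; rewrite -(hK K) //.
elim: {hK} K => [|K IHK]; first by rewrite big_ord0 coef1.
have := coef_vpoly_comp (\prod_(j < K) (vpoly v \Po 'X^(d ^ j))) 0 (Ordinal d_gt0).
by rewrite -prod_vpolyS IHK mulr1 (tnth_nth 0) v0.
Qed.

End Product.

(** * The digit recursion of [bit_diff f] and the resulting automaton *)

Theorem theorem1p1 (d : nat) (hd : (2 <= d)%N) (v : d.-tuple int)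
    (hv : forall i : 'I_d, tnth v i = 1 \/ tnth v i = -1)
    (hv0 : v`_0 = 1)
    (f : nat -> int)
    (hf : is_infprod (fun k => vpoly v \Po 'X^(d ^ k)) f) :
  automatic d (reduced_hankel_mod2 f).
Proof.
have d0 : (0 < d)%N := ltnW hd.
have fE := infprod_digit d v d0 f hf.
have f0 := infprod0 d v d0 f hf hv0.
have f_pm1 k : f k = 1 \/ f k = -1.
  have [N] := ubnP k; elim: N k => // N IHN [|k] kN; first by left.
  rewrite (divn_eq k.+1 d) (fE _ (Ordinal (ltn_pmod k.+1 d0))).
  have /IHN : (k.+1 %/ d < N)%N by apply: leq_trans (ltn_Pdiv hd _) _.
  move: (hv (Ordinal (ltn_pmod k.+1 d0))) => [] -> [] ->; by [left|right].
(* The index is cyclic because after digit [d - 1] the next integer ends in 0, with a carry from [q]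
   to [q + 1]. *)
pose c r : 'F_2 := sign_bit v`_r + sign_bit v`_(r.+1 %% d).
have fq q s : (s < d)%N ->
    sign_bit (f (q * d + s)%N) = sign_bit v`_s + sign_bit (f q).
  by move=> sd; rewrite (fE q (Ordinal sd)) sign_bitM // (tnth_nth 0).
have yE q r : (r < d)%N ->
    bit_diff f (q * d + r)%N = c r + bit_diff f q *+ (r == d.-1).
  move=> rd.
  rewrite /bit_diff /c fq //; case: eqP => [rE|/eqP rE].
    have rSd : r.+1 = d by rewrite rE prednK.
    have -> : (q * d + r).+1 = (q.+1 * d + 0)%N by rewrite mulSn; lia.
    by rewrite fq // mulr1n rSd modnn addrACA.
  (* Without a carry both terms contain the sign bit of [f q], which cancels in characteristic 2. *)
  have rd1 : (r.+1 < d)%N by lia.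
  rewrite -addnS fq // modn_small // mulr0n addr0 addrACA.
  by rewrite -mulr2n [_ *+ 2](_ : _ = 0) ?addr0 // -mulr_natl pchar_Zp // mul0r.
(* Window entry [(1, 0)] of the state at [n] is the profile of sizes [n] and [n.-1], as
   [reduced_hankel_mod2_profile] requires. *)
apply: (automatic_of_step _ _ _ _ _ _
  (fun s : state 'F_2 => (((true, 1, 0) \in s (1, 0)) &&
                          ((true, 0, 0) \notin s (1, 0)))%:R) hd
  (state_at_step 'F_2 (bit_diff f) d c d0 yE)) => n.
by rewrite reduced_hankel_mod2_profile // ffunE /= addn1 addn0.
Qed.
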